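(* Every $n$-vertex graph $G$ satisfies $\pi_3(G)\le (1/2+o(1))n^2$; that is, there is a function $f(n)=o(n^2)$ such that for every $n$ and every graph $G$ on $n$ vertices, $\pi_3(G)\le n^2/2+f(n)$.
   Context: For a graph $G$, $\pi_3(G)$ is the minimum integer $m$ such that the edge set of $G$ can be decomposed (partitioned) into the edge sets of complete subgraphs $C_1,\ldots,C_\ell$ of $G$, each of order two or three (i.e., copies of $K_2$ and $K_3$), with $|C_1|+\cdots+|C_\ell|=m$, where $|C_i|$ is the number of vertices of $C_i$. *)

(* Defs.v *)
From mathcomp Require Import all_boot.

Set Implicit Arguments.
Unset Strict Implicit.
Unset Printing Implicit Defensive.

Record sgraph (T : finType) := SGraph {
  adj : rel T;
  adj_sym : symmetric adj;
  adj_irrefl : irreflexive adj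
}.

Section Decompositions.

Variables (T : finType) (G : sgraph T).
Implicit Types (C : {set T}) (D : {set {set T}}).

Definition edges : {set {set T}} :=
  [set [set p.1; p.2] | p : T * T & adj G p.1 p.2].

Definition complete_subgraph C : bool :=
  [forall x in C, forall y in C, (x != y) ==> adj G x y].

Definition clique_edges C : {set {set T}} := [set A in powerset C | #|A| == 2].

(* A decomposition is a set, not a list, of vertex sets: a list would have no
   repetition anyway, since each member has at least one edge. On vertex sets of
   order at least two clique_edges is injective, so taking the image @: does not
   identify distinct members. *)
Definition decomposition3 D : bool :=
  [forall C in D, complete_subgraph C && ((#|C| == 2) || (#|C| == 3))]
  && partition [set clique_edges C | C in D] edges.

Definition decomposition3_weight (m : nat) : bool :=
  [exists D, decomposition3 D && (\sum_(C in D) #|C| == m)].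

Lemma ex_decomposition3_weight : exists m, decomposition3_weight m.
Proof.
have edgeP C : C \in edges -> complete_subgraph C /\ #|C| = 2.
  case/imsetP => -[x y]; rewrite inE /= => xy ->.
  have nxy : x != y by apply: contraTneq xy => ->; rewrite adj_irrefl.
  split; last by rewrite cards2 nxy.
  apply/'forall_implyP => u /set2P ux; apply/'forall_implyP => v /set2P vx.
  by apply/implyP; case: ux => ->; case: vx => ->; rewrite ?eqxx // adj_sym.
have clE C : C \in edges -> clique_edges C = [set C].
  case/edgeP => _ cC; apply/setP => A; rewrite !inE.
  apply/andP/eqP => [[AC /eqP cA]|->]; last by rewrite cC.
  by apply/eqP; rewrite eqEcard AC cC cA.
exists (\sum_(C in edges) #|C|); apply/existsP; exists edges.
rewrite eqxx andbT; apply/andP; split.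
  by apply/'forall_implyP => C /edgeP[-> ->].
rewrite (eq_in_imset clE); apply/and3P; split.
- rewrite cover_imset; apply/eqP/setP => A; apply/bigcupP/idP.
    by case=> C CE /set1P ->.
  by move=> AE; exists A; rewrite ?set11.
- apply/trivIsetP => _ _ /imsetP[A _ ->] /imsetP[B _ ->] AB.
  by rewrite disjoints1 inE; apply: contraNneq AB => ->.
- by apply/imsetP => -[A _ /setP/(_ A)]; rewrite !inE eqxx.
Qed.

Definition pi3 : nat := ex_minn ex_decomposition3_weight.

End Decompositions.

(* Main.v *)
Require Import Defs.
From mathcomp Require Import all_boot all_order all_algebra.
From mathcomp Require Import ring lra zify.
Import Order.TTheory GRing.Theory Num.Theory.
Local Open Scope ring_scope.

Set Implicit Arguments.
Unset Strict Implicit.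
Unset Printing Implicit Defensive.

(**
Taking [t] edge-disjoint triangles and the remaining edges costs [2|E| - 3t], so
one needs about [(2|E| - n^2/2)/3] edge-disjoint triangles.

A fractional triangle packing of that size, all of whose weights are [O(1/n)],
exists by linear programming duality: a dual solution consists of edge weights
[w] and triangle slacks [s] with [w(xy) + w(yz) + w(xz) + s(xyz) >= 1], and
[u = 2 - 3w] then satisfies [u(xz) + u(yz) <= 2 + 3s(xyz)] whenever
[u(xy) >= 1]. Mantel's argument, deleting the ends of a pair with [u(xy) >= 1]
and small total slack, bounds the sum of [u] by [n^2/2], up to the slack.

A fractional matching of a 3-uniform hypergraph (here: edges of the graph as
points, triangles as hyperedges) with small codegrees is turned into an actual
matching of almost the same size by the nibble. One bite with parameter [e]
keeps a matching of about [e] times the total weight and leaves a fractional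
matching of [1 - e] times the total weight, so a guaranteed ratio [c] improves
to [c + e((1 - e)^3 - c)]; iterating brings the ratio arbitrarily close to [1].
*)

(** * Linear programming duality *)

Section Farkas.
Variable R : realFieldType.

(** Supplies the value of an eliminated variable: [P] indexes its upper bounds, [N] its lower
    bounds. *)
Lemma separating_point (J : finType) (P N : pred J) (B : J -> R) :
    (forall p q, P p -> N q -> B q <= B p) ->
  exists z, (forall p, P p -> z <= B p) /\ (forall q, N q -> B q <= z).
Proof.
move=> leNP; case: (pickP P) => [p0 Pp0|P0].
  case: (arg_minP B Pp0) => p Pp minp; exists (B p); split=> // q Nq.
  exact: leNP.
case: (pickP N) => [q0 Nq0|N0].
  case: (arg_maxP B Nq0) => q Nq maxq; exists (B q); split=> // p.
  by rewrite P0.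
by exists 0; split=> k; rewrite ?P0 ?N0.
Qed.

Variables (I V : finType) (a : I -> V -> R) (b : I -> R).

(** The inequality with coefficients [f] and bound [r] follows from the system by nonnegative
    multipliers. Carrying the multipliers through the elimination turns a final contradiction into a
    Farkas certificate. *)
Definition conic (f : V -> R) (r : R) :=
  exists y : I -> R, [/\ forall i, 0 <= y i,
    forall j, f j = \sum_i y i * a i j & r = \sum_i y i * b i].

Lemma conic0 : conic (fun=> 0) 0.
Proof.
by exists (fun=> 0); split=> // [j|]; rewrite big1 // => i _; rewrite mul0r.
Qed.

Lemma conic_comb c d f r g s : 0 <= c -> 0 <= d -> conic f r -> conic g s ->
  conic (fun j => c * f j + d * g j) (c * r + d * s).
Proof.
move=> c0 d0 [y [y0 fy ry]] [z [z0 gz sz]].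
exists (fun i => c * y i + d * z i); split=> [i|j|].
- by rewrite addr_ge0 ?mulr_ge0.
- rewrite fy gz !mulr_sumr -big_split; apply: eq_bigr => i _ /=; ring.
- rewrite ry sz !mulr_sumr -big_split; apply: eq_bigr => i _ /=; ring.
Qed.

(** Induction on the set [W] of variables still present. The index type [J] is arbitrary because
    each elimination step changes it. *)
Lemma fourier_motzkin (W : {set V}) (J : finType) (f : J -> V -> R) (r : J -> R) :
    (forall k, conic (f k) (r k)) -> (forall k j, j \notin W -> f k j = 0) ->
  (exists x : V -> R, forall k, \sum_j f k j * x j <= r k) \/
  (exists2 s, s < 0 & conic (fun=> 0) s).
Proof.
have [m] := ubnP #|W|; elim: m W J f r => // m IHm W J f r ltWm cf f0.
have [W0|[v vW]] := set_0Vmem W.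
  case: (pickP (fun k => r k < 0)) => [k rk0|r_ge0].
    right; exists (r k) => //; have [y [y0 fy ry]] := cf k.
    by exists y; split=> // j; rewrite -fy f0 // W0 inE.
  left; exists (fun=> 0) => k; rewrite big1 => [|j _]; last by rewrite mulr0.
  by rewrite leNgt r_ge0.
(* Elimination of [v]: rows free of [v] are kept, and rows of opposite signs at [v] are combined in
   pairs so that [v] cancels. The other indices hold the trivial row [0 <= 0]. *)
pose f' (k : J + J * J) j := match k with
  | inl k => if f k v == 0 then f k j else 0
  | inr (p, q) => if (0 < f p v) && (f q v < 0)
                  then - f q v * f p j + f p v * f q j else 0 end.
pose r' (k : J + J * J) := match k with
  | inl k => if f k v == 0 then r k else 0
  | inr (p, q) => if (0 < f p v) && (f q v < 0)
                  then - f q v * r p + f p v * r q else 0 end.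
have [|||[x xP]|] := IHm (W :\ v) _ f' r'; last by right.
- by move: ltWm; rewrite (cardsD1 v) vW.
- move=> [k|[p q]]; rewrite /f' /r'; first by case: ifP => _ //; apply: conic0.
  case: ifP => [/andP[p0 q0]|_]; last exact: conic0.
  by apply: conic_comb => //; rewrite ?oppr_ge0 ltW.
- move=> k j; rewrite !inE negb_and negbK => /orP[/eqP->|jW].
    case: k => [k|[p q]] /=; first by case: ifP => // /eqP.
    by case: ifP => // _; ring.
  case: k => [k|[p q]] /=; case: ifP => // _; rewrite !(f0 _ j) //; ring.
(* A row with [f k v != 0] bounds the variable [v] by [(r k - rest k) / f k v], on the side given by
   the sign. The combined rows say that no lower bound exceeds an upper bound. *)
left; pose rest k := \sum_(j | j != v) f k j * x j.
have [|z [zP zN]] := @separating_point J (fun p => 0 < f p v) (fun q => f q v < 0)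
    (fun k => (r k - rest k) / f k v).
  move=> p q p0 q0; have := xP (inr (p, q)).
  rewrite /= p0 q0 /= (bigD1 v) //= addrC.
  have -> : \sum_(i | i != v) (- f q v * f p i + f p v * f q i) * x i =
      - f q v * rest p + f p v * rest q.
    by rewrite !mulr_sumr -big_split; apply: eq_bigr => i _ /=; ring.
  rewrite -subr_ge0 => h; rewrite -subr_ge0.
  have -> : (r p - rest p) / f p v - (r q - rest q) / f q v =
     (- f q v * r p + f p v * r q - (- f q v * rest p + f p v * rest q +
       (- f q v * f p v + f p v * f q v) * x v)) / (f p v * - f q v).
    by field; rewrite (lt0r_neq0 p0) (ltr0_neq0 q0).
  by rewrite divr_ge0 // mulr_ge0 ?oppr_ge0 // ltW.
exists (fun j => if j == v then z else x j) => k.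
rewrite (bigD1 v) //= eqxx.
have -> : \sum_(i | i != v) f k i * (if i == v then z else x i) = rest k.
  by apply: eq_bigr => i /negPf->.
rewrite -lerBrDr mulrC; case: (ltgtP (f k v) 0) => fk0.
- by rewrite -ler_ndivrMr //; apply: zN.
- by rewrite -ler_pdivlMr //; apply: zP.
have := xP (inl k); rewrite /= fk0 eqxx (bigD1 v) //= fk0 mul0r add0r mulr0.
by rewrite subr_ge0.
Qed.

Lemma farkas :
  (exists x : V -> R, forall i, \sum_j a i j * x j <= b i) \/
  (exists y : I -> R, [/\ forall i, 0 <= y i,
     forall j, \sum_i y i * a i j = 0 & \sum_i y i * b i < 0]).
Proof.
have [|k j|[x xP]|[s s0 [y [y0 ay bs]]]] := @fourier_motzkin [set: V] I a b.
- move=> k; exists (fun i => (i == k)%:R); split=> [i|j|]; first exact: ler0n.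
    by rewrite (bigD1 k) //= eqxx mul1r big1 ?addr0 // => i /negPf->; rewrite mul0r.
  by rewrite (bigD1 k) //= eqxx mul1r big1 ?addr0 // => i /negPf->; rewrite mul0r.
- by rewrite inE.
- by left; exists x.
- by right; exists y; split=> //; rewrite -bs.
Qed.

End Farkas.

(** Farkas for packings capped at [d] of total weight at least [b]: a certificate of infeasibility,
    once scaled, is a fractional cover [w] with slacks [s] that costs less than [b]. *)
Lemma capped_packing_duality (R : realFieldType) (X : finType) (D : {set X})
    (Hs : {set {set X}}) (d b : R) : 0 <= d ->
    (forall (w : X -> R) (s : {set X} -> R), (forall e, 0 <= w e) ->
       (forall h, 0 <= s h) ->
       (forall h, h \in Hs -> 1 <= \sum_(e in h) w e + s h) ->
       b <= \sum_(e in D) w e + d * \sum_(h in Hs) s h) ->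
    (forall h, h \in Hs -> h \subset D) ->
  exists t : {set X} -> R, [/\ forall h, 0 <= t h <= d,
    forall h, h \notin Hs -> t h = 0,
    forall e, \sum_(h : {set X} | e \in h) t h <= 1 & b <= \sum_h t h].
Proof.
move=> d0 dual HsD.
(* The blocks of rows are nonnegativity, the cap, the loads and the total weight. Columns outside
   [Hs] vanish, and those variables are set to [0] in the solution. *)
pose a (i : {set X} + {set X} + X + unit) (h : {set X}) : R :=
  (h \in Hs)%:R * match i with
  | inl (inl (inl g)) => - (g == h)%:R
  | inl (inl (inr g)) => (g == h)%:R
  | inl (inr e) => (e \in h)%:R
  | inr _ => -1 end.
pose c (i : {set X} + {set X} + X + unit) : R := match i with
  | inl (inl (inl g)) => 0
  | inl (inl (inr g)) => (g \in Hs)%:R * d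
  | inl (inr e) => (e \in D)%:R
  | inr _ => - b end.
have sumHs F : \sum_h (h \in Hs)%:R * F h = \sum_(h in Hs) F h :> R.
  by rewrite [RHS]big_mkcond; apply: eq_bigr => h _; case: ifP; rewrite ?mul1r ?mul0r.
have sum1 (F : {set X} -> R) g :
    \sum_h (h \in Hs)%:R * (g == h)%:R * F h = (g \in Hs)%:R * F g.
  rewrite (bigD1 g) //= eqxx mulr1 big1 ?addr0 // => h /negPf.
  by rewrite eq_sym => ->; rewrite mulr0 mul0r.
have [[x xP]|[y [y0 ya yc]]] := farkas a c.
  exists (fun h => if h \in Hs then x h else 0).
  have x_ge0 h : h \in Hs -> 0 <= x h.
    move=> hH; have := xP (inl (inl (inl h))); rewrite /a /c.
    under eq_bigr do rewrite mulrN mulNr.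
    by rewrite sumrN sum1 hH mul1r oppr_le0.
  split=> [h|h /negPf-> //|e|].
  - case: ifP => hH; rewrite ?lexx ?d0 // x_ge0 //=.
    by have := xP (inl (inl (inr h))); rewrite /a /c sum1 hH !mul1r.
  - have [eD|eD] := boolP (e \in D).
      have := xP (inl (inr e)); rewrite /a /c eD; apply: le_trans.
      rewrite big_mkcond /= le_eqVlt; apply/orP; left; apply/eqP.
      apply: eq_bigr => h _; case: (h \in Hs); case: (e \in h); rewrite /=; ring.
    rewrite big1 // => h eh; case: ifP => // /HsD/subsetP/(_ e eh).
    by rewrite (negPf eD).
  - have := xP (inr tt); rewrite /a /c.
    under eq_bigr do rewrite mulrN1 mulNr.
    by rewrite sumrN sumHs lerN2 big_mkcond.
exfalso.
have sumU (F : unit -> R) : \sum_u F u = F tt.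
  by rewrite (bigD1 tt) //= big1 ?addr0 // => -[].
move: yc ya; rewrite !big_sumType /= => yc ya.
have sy1 (F : {set X} -> R) h : \sum_g F g * ((h \in Hs)%:R * (g == h)%:R) =
    F h * (h \in Hs)%:R.
  rewrite (bigD1 h) //= eqxx mulr1 big1 ?addr0 // => g /negPf->.
  by rewrite !mulr0.
set y1 := fun h => y (inl (inl (inl h))).
set y2 := fun h => y (inl (inl (inr h))).
set y3 := fun e => y (inl (inr e)).
set y4 := y (inr tt).
have {}yc : \sum_(e in D) y3 e + d * \sum_(h in Hs) y2 h < b * y4.
  move: yc; rewrite big1 => [|g _]; last by rewrite mulr0.
  rewrite add0r sumU mulrN subr_lt0 mulrC; congr (_ < _).
  rewrite addrC mulr_sumr; congr (_ + _).
    rewrite [RHS]big_mkcond; apply: eq_bigr => e _.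
    by case: ifP; rewrite ?mulr1 ?mulr0.
  rewrite -sumHs; apply: eq_bigr => h _; rewrite /y2; ring.
have {}ya h : h \in Hs -> y4 <= \sum_(e in h) y3 e + y2 h.
  move=> hH; have := ya h; rewrite !big_sumType /= sumU /a sy1 hH.
  under eq_bigr do rewrite mul1r mulrN.
  rewrite sumrN.
  have -> : \sum_g y (inl (inl (inl g))) * (g == h)%:R = y1 h.
    by rewrite (bigD1 h) //= eqxx mulr1 big1 ?addr0 // => g /negPf->; rewrite mulr0.
  have -> : \sum_e y (inl (inr e)) * (true%:R * (e \in h)%:R) = \sum_(e in h) y3 e.
    rewrite [RHS]big_mkcond; apply: eq_bigr => e _.
    by case: ifP => _; rewrite ?mulr1 ?mulr0.
  have := y0 (inl (inl (inl h))); rewrite -/(y1 h) -/(y2 h) -/y4 => y1_ge0.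
  by rewrite mulrN !mul1r !mulr1; lra.
(* [y4] is the multiplier of the total weight. If it is zero, the other multipliers cannot give a
   negative value; otherwise dividing by it gives the cover. *)
have := y0 (inr tt); rewrite -/y4 le_eqVlt => /orP[/eqP y40|y4_gt0].
  move: yc; rewrite -y40 mulr0 ltNge addr_ge0 ?sumr_ge0 ?mulr_ge0 // => [e _|].
    exact: y0.
  by rewrite sumr_ge0 // => h _; apply: y0.
have := dual (fun e => y3 e / y4) (fun h => y2 h / y4).
rewrite -!mulr_suml mulrA -mulrDl => bound.
have : b <= (\sum_(e in D) y3 e + d * \sum_(h in Hs) y2 h) / y4; last first.
  by rewrite ler_pdivlMr // leNgt yc.
apply: bound.
- by move=> e; apply: divr_ge0; [apply: y0 | apply: ltW].
- by move=> h; apply: divr_ge0; [apply: y0 | apply: ltW].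
- by move=> h hH; rewrite -mulr_suml -mulrDl ler_pdivlMr // mul1r ya.
Qed.

(** * A weighted Mantel theorem *)

Section Mantel.
Variables (R : realFieldType) (T : finType).

Lemma sum_symD1 (F : T -> T -> R) (W : {set T}) x :
    (forall y z, F y z = F z y) -> x \in W ->
  \sum_(y in W) \sum_(z in W) F y z =
  F x x + 2 * (\sum_(z in W :\ x) F x z)
    + \sum_(y in W :\ x) \sum_(z in W :\ x) F y z.
Proof.
move=> symF xW; rewrite (big_setD1 x) //= (big_setD1 x) //=.
rewrite [X in _ + X](eq_bigr (fun y => F x y + \sum_(z in W :\ x) F y z)).
  by rewrite big_split /=; ring.
by move=> y _; rewrite (big_setD1 x) //= symF.
Qed.

Variables (u : T -> T -> R) (sg : T -> T -> T -> R) (K : R).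
Hypotheses (u_sym : forall x y, u x y = u y x) (u_diag : forall x, u x x = 0).
Hypotheses (u_le2 : forall x y, u x y <= 2) (sg_ge0 : forall x y z, 0 <= sg x y z).
Hypothesis u_sg : forall x y z, 1 <= u x y -> u x z + u y z <= 2 + sg x y z.
Hypothesis K_ge0 : 0 <= K.

(* Mantel's induction: delete the two ends of a pair of weight at least one,
   as long as there is such a pair whose total slack is at most [K]. *)
Lemma weighted_mantel_in (W : {set T}) :
  \sum_(x in W) \sum_(y in W) u x y <= #|W|%:R ^+ 2 + K * #|W|%:R
    + \sum_(x in W) \sum_(y in W) (K < \sum_z sg x y z)%R%:R.
Proof.
have [m] := ubnP #|W|; elim: m W => // m IHm W ltWm.
case: (pickP (fun p => [&& p.1 \in W, p.2 \in W, 1 <= u p.1 p.2 &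
                         \sum_z sg p.1 p.2 z <= K])) => [[x y] /=|noP].
  case/and4P=> xW yW uxy sxy.
  have nyx : y != x by apply: contraTneq uxy => ->; rewrite u_diag ler10.
  have yWx : y \in W :\ x by rewrite !inE nyx.
  rewrite (sum_symD1 u_sym xW) (sum_symD1 u_sym yWx) !u_diag.
  rewrite (big_setD1 y) //=; set W' := W :\ x :\ y.
  have cW : #|W|%:R = #|W'|%:R + 2 :> R.
    by rewrite (cardsD1 x) xW (cardsD1 y (W :\ x)) yWx addnA natrD addrC.
  have {IHm} := IHm W'; rewrite -/W'.
  have -> : (#|W'| < m)%N.
    by move: ltWm; rewrite (cardsD1 x) xW (cardsD1 y (W :\ x)) yWx /= => /ltnW.
  move=> /(_ isT) IH; rewrite cW.
  have le_big : \sum_(x in W') \sum_(y in W') (K < \sum_z sg x y z)%R%:R <=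
                \sum_(x in W) \sum_(y in W) (K < \sum_z sg x y z)%R%:R :> R.
    have sW : {subset W' <= W} by move=> z; rewrite !inE => /and3P[].
    rewrite [leRHS](bigID (mem W')) /= -[leLHS]addr0 lerD //; last first.
      by apply: sumr_ge0 => a _; apply: sumr_ge0 => b _.
    rewrite [leRHS](eq_bigl (mem W')) => [|a /=]; last first.
      by apply: andb_idl => /sW.
    apply: ler_sum => a _; rewrite [leRHS](bigID (mem W')) /= -[leLHS]addr0 lerD //.
      rewrite [leRHS](eq_bigl (mem W')) // => b /=.
      by apply: andb_idl => /sW.
    by apply: sumr_ge0.
  have le_uv : \sum_(z in W') u x z + \sum_(z in W') u y z <= 2 * #|W'|%:R + K.
    rewrite -big_split /=; apply: le_trans (_ : \sum_(z in W') (2 + sg x y z) <= _).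
      by apply: ler_sum => z _; apply: u_sg.
    rewrite big_split /= sumr_const mulr_natr lerD // (le_trans _ sxy) //.
    by rewrite [leRHS](bigID (mem W')) /= lerDl sumr_ge0.
  have := u_le2 x y; lra.
(* Now each pair has weight below one, or slack above [K] and weight at most two. *)
apply: le_trans (_ : \sum_(x in W) \sum_(y in W)
    (1 + (K < \sum_z sg x y z)%R%:R) <= _).
  apply: ler_sum => x xW; apply: ler_sum => y yW.
  have := noP (x, y); rewrite /= xW yW /=; case: (ltP K) => [_ _|_].
    by apply: le_trans (u_le2 x y) _; rewrite -[true%:R]/(1 : R); lra.
  by rewrite andbT addr0 => /negbT; rewrite -ltNge => /ltW.
under eq_bigr do rewrite big_split /= sumr_const.
rewrite big_split /= sumr_const -mulrnA natrM -expr2 lerD //.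
by rewrite lerDl mulr_ge0.
Qed.

(** Markov's inequality bounds the number of pairs of slack above [K] by the total slack over
    [K]. *)
Lemma weighted_mantel : 0 < K ->
  \sum_x \sum_y u x y <= #|T|%:R ^+ 2 + K * #|T|%:R
    + (\sum_x \sum_y \sum_z sg x y z) / K.
Proof.
move=> K_gt0; have := weighted_mantel_in [set: T]; rewrite cardsT.
under eq_bigl do rewrite inE; under eq_bigr do under eq_bigl do rewrite inE.
under [X in _ <= _ + X -> _]eq_bigl do rewrite inE.
under [X in _ <= _ + X -> _]eq_bigr do under eq_bigl do rewrite inE.
move=> /le_trans; apply; rewrite lerD2l mulr_suml; apply: ler_sum => x _.
rewrite mulr_suml; apply: ler_sum => y _; case: ltP => [/ltW h|_].
  by rewrite ler_pdivlMr // mul1r.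
by rewrite divr_ge0 // sumr_ge0.
Qed.

End Mantel.

(** * The nibble *)

Section RandomSet.
Variables (R : realFieldType) (I : finType).

(** Weierstrass's product inequality, which serves as the union bound. *)
Lemma prod_1B_itv (a : I -> R) (P : pred I) :
    (forall i, P i -> 0 <= a i <= 1) ->
  1 - \sum_(i | P i) a i <= \prod_(i | P i) (1 - a i) <= 1.
Proof.
move=> a01.
pose Q (x y : R) := [&& 1 - x <= y, 0 <= y & y <= 1].
have : Q (\sum_(i | P i) a i) (\prod_(i | P i) (1 - a i)); last first.
  by case/and3P=> -> _ ->.
elim/big_rec2: _ => [|i y x /a01/andP[a0 a1] /and3P[h1 h2 h3]].
  by rewrite /Q subr0 lexx ler01.
by apply/and3P; split; nra.
Qed.

Lemma disjointUr (A B C : {set I}) :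
  [disjoint A & B :|: C] = [disjoint A & B] && [disjoint A & C].
Proof. by rewrite -!setI_eq0 setIUr setU_eq0. Qed.

Variable p : I -> R.
Hypothesis p01 : forall i, 0 <= p i <= 1.

Definition pr (A : {set I}) : R := \prod_i (if i \in A then p i else 1 - p i).

Definition expect (f : {set I} -> R) : R := \sum_A pr A * f A.

Lemma pr_ge0 A : 0 <= pr A.
Proof.
apply: prodr_ge0 => i _; have /andP[p0 p1] := p01 i.
by case: ifP; rewrite ?subr_ge0.
Qed.

(** Expanding a product of sums gives one term per set [A]; a zero summand at each element of [B]
    kills the sets that meet [B]. *)
Lemma expect_disjoint (B : {set I}) :
  expect (fun A => [disjoint A & B]%:R) = \prod_(i in B) (1 - p i).
Proof.
have -> : \prod_(i in B) (1 - p i) =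
    \prod_i ((if i \in B then 0 else p i) + (1 - p i)).
  rewrite [LHS]big_mkcond; apply: eq_bigr => i _; case: ifP => _; ring.
rewrite bigA_distr; apply: eq_bigr => A _; rewrite /pr.
case: (boolP [disjoint A & B]) => [dAB|].
  rewrite mulr1; apply: eq_bigr => i _; case: ifP => // iA.
  by rewrite (disjointFr dAB).
rewrite -setI_eq0 => /set0Pn[i]; rewrite inE => /andP[iA iB].
by rewrite mulr0 (bigD1 i) //= iA iB mul0r.
Qed.

Lemma expectD f g : expect (fun A => f A + g A) = expect f + expect g.
Proof. by rewrite -big_split; apply: eq_bigr => A _; rewrite mulrDr. Qed.

Lemma expectZ c f : expect (fun A => c * f A) = c * expect f.
Proof. by rewrite mulr_sumr; apply: eq_bigr => A _; rewrite mulrCA. Qed.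

Lemma expect_sum (J : finType) (P : pred J) (f : J -> {set I} -> R) :
  expect (fun A => \sum_(j | P j) f j A) = \sum_(j | P j) expect (f j).
Proof.
rewrite exchange_big; apply: eq_bigr => A _ /=.
by rewrite mulr_sumr; apply: eq_bigr.
Qed.

Lemma eq_expect f g : f =1 g -> expect f = expect g.
Proof. by move=> fg; apply: eq_bigr => A _; rewrite fg. Qed.

Lemma ler_expect f g : (forall A, f A <= g A) -> expect f <= expect g.
Proof. by move=> fg; apply: ler_sum => A _; rewrite ler_wpM2l ?pr_ge0. Qed.

Lemma expect1 : expect (fun=> 1) = 1.
Proof.
apply: etrans (_ : \prod_(i in set0) (1 - p i) = 1); last by rewrite big_set0.
by rewrite -expect_disjoint; apply: eq_expect => A; rewrite -setI_eq0 setI0 eqxx.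
Qed.

(** The event is the difference of avoiding [B] and avoiding [i |: B]. *)
Lemma expect_mem_disjoint i (B : {set I}) : i \notin B ->
  expect (fun A => ((i \in A) && [disjoint A & B])%:R) =
  p i * \prod_(j in B) (1 - p j).
Proof.
move=> iB; have := expect_disjoint (i |: B); rewrite big_setU1 //=.
have := expect_disjoint B; set f := expect _ => fE; set g := expect _ => gE.
have -> : p i * \prod_(j in B) (1 - p j) = f + -1 * g by rewrite fE gE; ring.
rewrite -expectZ -expectD; apply: eq_expect => A.
rewrite disjointUr [[disjoint A & [set i]]]disjoint_sym disjoints1.
by case: (i \in A); case: [disjoint A & B]; rewrite /=; ring.
Qed.

(** The first moment method. *)
Lemma expect_attained a f : a <= expect f -> exists A, a <= f A.
Proof.
move=> aE; apply/existsP/existsPn => noA; move: aE; apply/negP; rewrite -ltNge.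
have -> : a = expect (fun=> a).
  rewrite -[a in LHS]mulr1 -expect1 -expectZ.
  by apply: eq_expect => A; rewrite mulr1.
rewrite -subr_gt0 -mulN1r -expectZ -expectD.
have [A prA] : exists A, 0 < pr A.
  apply/existsP/existsPn => pr0; have := expect1; rewrite /expect big1 => [|A _].
    by move/eqP; rewrite eq_sym oner_eq0.
  by have := pr0 A; rewrite lt0r pr_ge0 andbT negbK => /eqP->; rewrite mul0r.
apply: lt_le_trans (_ : pr A * (a + -1 * f A) <= _).
  by rewrite mulr_gt0 // mulN1r subr_gt0 ltNge noA.
rewrite /expect (bigD1 A) //= lerDl sumr_ge0 // => B _.
by rewrite mulr_ge0 ?pr_ge0 // mulN1r subr_ge0 ltW // ltNge noA.
Qed.

End RandomSet.

(** The hypergraph is left implicit as the support of [t]; [d] bounds its weighted codegrees. *)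
Definition fractional_matching3 (R : realFieldType) (X : finType) (D : {set X})
    (d : R) (t : {set X} -> R) :=
  [/\ forall h, 0 <= t h,
      forall h, t h != 0 -> #|h| = 3%N /\ h \subset D,
      forall x, \sum_(h : {set X} | x \in h) t h <= 1 &
      forall x y, x != y -> \sum_(h : {set X} | (x \in h) && (y \in h)) t h <= d].

(** * One bite of the nibble *)

Section Bite.
Variables (R : realFieldType) (X : finType) (D : {set X}) (d e : R).
Variable t : {set X} -> R.
Hypothesis tP : fractional_matching3 D d t.
Hypotheses (d_ge0 : 0 <= d) (d_le : d <= 50^-1) (e_gt0 : 0 < e) (e_le : e <= 2^-1).

Let t_ge0 h : 0 <= t h. Proof. by case: tP. Qed.
Let t_card h : t h != 0 -> #|h| = 3%N. Proof. by case: tP => _ H _ _ /H[]. Qed.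
Let t_sub h : t h != 0 -> h \subset D. Proof. by case: tP => _ H _ _ /H[]. Qed.
Let load x := \sum_(h : {set X} | x \in h) t h.
Let load_le1 x : load x <= 1. Proof. by case: tP => _ _ H _; apply: H. Qed.
Let codeg_le x y : x != y -> \sum_(h : {set X} | (x \in h) && (y \in h)) t h <= d.
Proof. by case: tP => _ _ _; apply. Qed.

Lemma bite_t_le1 h : t h <= 1.
Proof.
have [->|th] := eqVneq (t h) 0; first exact: ler01.
have [x xh] : exists x, x \in h by apply/set0Pn; rewrite -card_gt0 (t_card th).
apply: le_trans (load_le1 x).
by rewrite /load (bigD1 h) //= lerDl sumr_ge0.
Qed.

Definition hit (U : {set X}) : {set {set X}} := [set i : {set X} | ~~ [disjoint i & U]].

Lemma hitU U U' : hit (U :|: U') = hit U :|: hit U'.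
Proof. by apply/setP => i; rewrite !inE disjointUr negb_and. Qed.

Lemma mem_hit1 x i : (i \in hit [set x]) = (x \in i).
Proof. by rewrite inE disjoint_sym disjoints1 negbK. Qed.

(* Besides choosing each triple [h] with probability [e * t h], the bite deletes
   single points, so that every point survives with probability exactly [1 - e]
   whatever its load. *)
Definition bite_prob (i : {set X}) : R :=
  if #|i| == 1%N then 1 - (1 - e) / \prod_(h in hit i) (1 - e * t h) else e * t i.
Local Notation p := bite_prob.

(** Singletons carry no weight, so they are free to encode deletions: choosing [[set x]] destroys
    the point [x] only. *)
Lemma bite_t1 x : t [set x] = 0.
Proof. by apply/eqP/negPn/negP => /t_card; rewrite cards1. Qed.

Lemma bite_et_itv h : 0 <= e * t h <= 1.
Proof.
rewrite mulr_ge0 ?(ltW e_gt0) //=; apply: mulr_ile1 => //; first exact: ltW.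
  by have := e_le; lra.
exact: bite_t_le1.
Qed.

(** By the union bound, triples alone destroy [x] with probability at most [e]; hence the deletion
    probability that tops this up to [e] is nonnegative. *)
Lemma bite_prod_load x :
  1 - e <= \prod_(h in hit [set x]) (1 - e * t h) <= 1.
Proof.
have := @prod_1B_itv R _ (fun h => e * t h) (mem (hit [set x])) (fun h _ => bite_et_itv h).
case/andP=> h1 ->; rewrite andbT (le_trans _ h1) //.
rewrite -mulr_sumr lerD2l lerN2 (eq_bigl (fun h : {set X} => x \in h)) => [|h].
  by rewrite ler_piMr ?(ltW e_gt0) //; apply: load_le1.
exact: mem_hit1.
Qed.

Lemma bite_prob_itv i : 0 <= p i <= 1.
Proof.
rewrite /p; case: ifP => [/cards1P[x ->]|_]; last exact: bite_et_itv.
have /andP[h1 h2] := bite_prod_load x.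
have P0 : 0 < \prod_(h in hit [set x]) (1 - e * t h).
  by apply: lt_le_trans h1; have := e_le; lra.
rewrite subr_ge0 ler_pdivrMr // mul1r h1 /= lerBlDr lerDl divr_ge0 ?ltW //.
by have := e_le; lra.
Qed.

Lemma bite_prob1B_ge0 i : 0 <= 1 - p i.
Proof. by rewrite subr_ge0; case/andP: (bite_prob_itv i). Qed.

(** The factor of [[set x]] is [1 - e] divided by the product of the other factors: its own term in
    the denominator of [bite_prob] is [1], by [bite_t1]. *)
Lemma bite_prod_point x : \prod_(i : {set X} | x \in i) (1 - p i) = 1 - e.
Proof.
have /andP[h1 _] := bite_prod_load x.
have P0 : 0 < \prod_(h in hit [set x]) (1 - e * t h).
  by apply: lt_le_trans h1; have := e_le; lra.
rewrite (bigD1 [set x]) ?set11 //= /p cards1 eqxx opprB addrC subrK.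
apply/eqP; rewrite mulrAC -subr_eq0 -[X in _ - X]mulr1 -mulrA -mulrBr mulf_eq0.
apply/orP; right; rewrite subr_eq0 -(inj_eq (mulIf (lt0r_neq0 P0))) mul1r divfK ?lt0r_neq0 //.
rewrite [X in _ == X](bigD1 [set x]) ?mem_hit1 ?set11 //= bite_t1 mulr0 subr0 mul1r.
apply/eqP/eq_big => [i|i /andP[xi nix]]; first by rewrite mem_hit1.
rewrite ifN //; apply: contra nix => /cards1P[y iE].
by move: xi; rewrite iE inE => /eqP->.
Qed.

(** By [expect_disjoint], the probability that no chosen set meets [U]. *)
Definition survival U := \prod_(i in hit U) (1 - p i).

Lemma survival_itv U : 0 <= survival U <= 1.
Proof.
rewrite prodr_ge0 => [|i _]; last exact: bite_prob1B_ge0.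
by case/andP: (@prod_1B_itv R _ p (mem (hit U)) (fun i _ => bite_prob_itv i)).
Qed.

Lemma bite_prob_pair x y (i : {set X}) : x != y -> x \in i -> y \in i -> p i = e * t i.
Proof.
move=> nxy xi yi; rewrite /p ifN //; apply: contra nxy => /cards1P[z iE].
by move: xi yi; rewrite iE !inE => /eqP-> /eqP->.
Qed.

(** Points survive almost independently. The sets through [x] contribute [r' * r = 1 - e], where
    [r'] comes from those that also meet [U]; by the codegree bound, [r'] is at least
    [1 - #|U| * d]. *)
Lemma survivalU1 x (U : {set X}) : x \notin U ->
  (1 - e) * survival U <= survival (x |: U) /\
  (1 - #|U|%:R * d) * survival (x |: U) <= (1 - e) * survival U.
Proof.
move=> xU.
pose r := \prod_(i in hit [set x] :\: hit U) (1 - p i).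
pose r' := \prod_(i in hit [set x] :&: hit U) (1 - p i).
have -> : survival (x |: U) = survival U * r.
  by rewrite /survival hitU (big_setID (hit U)) /= setIC setKU setDUl setDv setU0.
have rr' : r' * r = 1 - e.
  rewrite -(bite_prod_point x) /r /r' -big_setID /=.
  by apply: eq_bigl => i; rewrite mem_hit1.
have r_ge0 : 0 <= r by apply: prodr_ge0 => i _; apply: bite_prob1B_ge0.
have /andP[r'_ge r'_le1] := @prod_1B_itv R _ p (mem (hit [set x] :&: hit U))
  (fun i _ => bite_prob_itv i).
have {}r'_ge : 1 - #|U|%:R * d <= r'.
  apply: le_trans r'_ge; rewrite lerD2l lerN2.
  apply: le_trans (_ : \sum_(u in U) \sum_(i : {set X} | (x \in i) && (u \in i)) t i <= _).
    under [leRHS]eq_bigr do rewrite big_mkcond.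
    rewrite exchange_big big_mkcond; apply: ler_sum => i _ /=.
    case: ifP => [|_]; last by apply: sumr_ge0 => u _; case: ifP.
    rewrite inE mem_hit1 inE => /andP[xi /pred0Pn[u /andP[/= ui uU]]].
    have nxu : x != u by apply: contraNneq xU => ->.
    rewrite (bigD1 u) //= xi ui (bite_prob_pair nxu) //= -[leLHS]addr0 lerD //.
      by rewrite ler_piMl // (le_trans e_le) // invf_le1 ?ler1n.
    by apply: sumr_ge0 => v _; case: ifP.
  rewrite mulr_natl -sumr_const; apply: ler_sum => u uU.
  by apply: codeg_le; apply: contraNneq xU => ->.
have /andP[s0 s1] := survival_itv U.
rewrite -/r' in r'_le1; rewrite -rr'; split.
  by rewrite mulrC ler_wpM2l // ler_piMl.
rewrite mulrCA [leRHS]mulrC ler_wpM2l // ler_wpM2r //.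
Qed.

Lemma survival0 : survival set0 = 1.
Proof.
by apply: big1 => i; rewrite inE -setI_eq0 setI0 eqxx.
Qed.

Lemma survival_ge (U : {set X}) : (1 - e) ^+ #|U| <= survival U.
Proof.
have e1 : 0 <= 1 - e by have := e_le; lra.
have [m] := ubnP #|U|; elim: m U => // m IHm U ltUm.
have [->|[x xU]] := set_0Vmem U; first by rewrite cards0 survival0.
rewrite (cardsD1 x) xU exprS -[in leRHS](setD1K xU).
have [|h _] := @survivalU1 x (U :\ x); first by rewrite !inE eqxx.
apply: le_trans h; rewrite ler_wpM2l // IHm //.
by move: ltUm; rewrite (cardsD1 x) xU.
Qed.

Lemma survival_le (U : {set X}) : (#|U| <= 5)%N ->
  (1 - 5 * d) ^+ #|U| * survival U <= (1 - e) ^+ #|U|.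
Proof.
have e1 : 0 <= 1 - e by have := e_le; lra.
have d1 : 0 <= 1 - 5 * d by have := d_le; lra.
have [m] := ubnP #|U|; elim: m U => // m IHm U ltUm U5.
have [->|[x xU]] := set_0Vmem U; first by rewrite cards0 survival0 mulr1.
have [|_ h] := @survivalU1 x (U :\ x); first by rewrite !inE eqxx.
have {}IHm : (1 - 5 * d) ^+ #|U :\ x| * survival (U :\ x) <= (1 - e) ^+ #|U :\ x|.
  by apply: IHm; move: ltUm U5; rewrite (cardsD1 x) xU // => _ /ltnW.
move: U5; rewrite (cardsD1 x) xU !exprS add1n => U5.
apply: le_trans (ler_wpM2l e1 IHm); rewrite mulrAC [leRHS]mulrCA mulrC.
apply: ler_wpM2l; first by rewrite exprn_ge0.
move: h; rewrite setD1K //; apply: le_trans; apply: ler_wpM2r.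
  by case/andP: (survival_itv U).
rewrite lerD2l lerN2 ler_wpM2r // ler_nat; exact: ltnW.
Qed.

(** Five is the size of the union of two triples sharing one point; [25 = 5 * 5] comes from
    Bernoulli's inequality. *)
Lemma survival_le5 (U : {set X}) : #|U| = 5%N -> (1 - 25 * d) * survival U <= (1 - e) ^+ 5.
Proof.
move=> cU; have := @survival_le U; rewrite cU => /(_ isT); apply: le_trans.
apply: ler_wpM2r; first by case/andP: (survival_itv U).
have d1 : 0 <= 5 * d <= 1 by have := d_le; have := d_ge0; lra.
have /andP[] := @prod_1B_itv R 'I_5 (fun=> 5 * d) xpredT (fun _ _ => d1).
rewrite sumr_const prodr_const card_ord => h _; apply: le_trans h.
rewrite -mulr_natl; lra.
Qed.

Local Notation E := (expect p).
Local Notation surv U A := ([disjoint A & hit U]).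

Lemma hitS (U W : {set X}) : U \subset W -> hit U \subset hit W.
Proof. by move=> /setUidPr<-; rewrite hitU subsetUl. Qed.

Lemma surv_sub (U W : {set X}) (A : {set {set X}}) :
  U \subset W -> surv W A -> surv U A.
Proof. by move=> /hitS UW; apply: disjointWr. Qed.

Definition surviving_load x (A : {set {set X}}) : R :=
  \sum_(h : {set X} | x \in h) t h * (surv h A)%:R.
Local Notation L := surviving_load.

Lemma surviving_load_surv x A : L x A * (surv [set x] A)%:R = L x A.
Proof.
rewrite mulr_suml; apply: eq_bigr => h xh.
case: (boolP (surv h A)) => [sh|_]; last by rewrite mulr0 mul0r.
by rewrite (surv_sub _ sh) ?sub1set // !mulr1.
Qed.

Lemma expect_surviving_load_ge x : (1 - e) ^+ 3 * load x <= E (L x).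
Proof.
rewrite expect_sum mulr_sumr; apply: ler_sum => h xh.
rewrite expectZ expect_disjoint -/(survival h) mulrC.
have [->|th] := eqVneq (t h) 0; first by rewrite !mul0r.
by rewrite ler_wpM2l // -(t_card th) survival_ge.
Qed.

(** Such a [g] contains one of the two other points of [h], and each of these costs one codegree. *)
Lemma overlap_le (x : X) (h : {set X}) : x \in h -> t h != 0 ->
  \sum_(g : {set X} | (x \in g) && (h :&: g != [set x])) t g <= 2 * d.
Proof.
move=> xh th.
apply: le_trans (_ : \sum_(y in h :\ x) \sum_(g : {set X} | (x \in g) && (y \in g)) t g <= _).
  under [leRHS]eq_bigr do rewrite big_mkcond.
  rewrite exchange_big big_mkcond; apply: ler_sum => g _ /=.
  case: ifP => [/andP[xg hg]|_]; last by apply: sumr_ge0 => u _; case: ifP.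
  have /subsetPn[y] : ~~ (h :&: g \subset [set x]).
    by apply: contra hg => hg; rewrite eqEsubset hg sub1set inE xh.
  rewrite !inE => /andP[yh yg] nyx.
  rewrite (bigD1 y) /= ?inE ?nyx // xg yg lerDl sumr_ge0 // => u _.
  by case: ifP.
have c2 : #|h :\ x| = 2%N.
  by have := cardsD1 x h; rewrite xh (t_card th) => -[].
rewrite -c2 mulr_natl -sumr_const; apply: ler_sum => y.
by rewrite !inE => /andP[nyx _]; apply: codeg_le; rewrite eq_sym.
Qed.

(** In the expanded square, two triples meeting only in [x] survive together with probability about
    [(1 - e) ^+ 5]; the remaining pairs are bounded by [overlap_le]. *)
Lemma expect_sqr_surviving_load x :
  (1 - 25 * d) * E (fun A => L x A ^+ 2) <= (1 - e) ^+ 5 * load x ^+ 2 + 2 * d.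
Proof.
have -> : E (fun A => L x A ^+ 2) = \sum_(h : {set X} | x \in h)
    \sum_(g : {set X} | x \in g) t h * t g * survival (h :|: g).
  apply: etrans (_ : \sum_(h : {set X} | x \in h) E (fun A =>
     \sum_(g : {set X} | x \in g) t h * t g * (surv (h :|: g) A)%:R) = _); last first.
    apply: eq_bigr => h _; rewrite expect_sum; apply: eq_bigr => g _.
    by rewrite expectZ expect_disjoint.
  rewrite -expect_sum; apply: eq_expect => A; rewrite expr2 big_distrlr /=.
  apply: eq_bigr => h _; apply: eq_bigr => g _.
  by rewrite hitU disjointUr mulrACA -natrM mulnb.
have e1 : 0 <= 1 - e <= 1 by have := e_le; have := e_gt0; lra.
have d1 : 0 <= 1 - 25 * d <= 1 by have := d_le; have := d_ge0; lra.
rewrite mulr_sumr.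
apply: le_trans (_ : \sum_(h : {set X} | x \in h)
    t h * ((1 - e) ^+ 5 * load x + 2 * d) <= _); last first.
  rewrite -mulr_suml -/(load x) mulrDr mulrCA -expr2 lerD2l ler_piMl //.
  by rewrite mulr_ge0.
apply: ler_sum => h xh; have [->|th] := eqVneq (t h) 0.
  by rewrite mul0r big1 ?mulr0 // => g _; rewrite !mul0r.
under eq_bigr do rewrite -mulrA; rewrite -mulr_sumr mulrCA ler_wpM2l //.
rewrite mulr_sumr.
apply: le_trans (_ : \sum_(g : {set X} | x \in g) ((1 - e) ^+ 5 * t g +
    (if h :&: g != [set x] then t g else 0)) <= _); last first.
  rewrite big_split /= -mulr_sumr lerD2l -big_mkcondr /=; exact: overlap_le.
apply: ler_sum => g xg; have [->|tg] := eqVneq (t g) 0.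
  by rewrite mul0r !mulr0 if_same addr0.
have /andP[s0 s1] := survival_itv (h :|: g).
case: eqP => [hg|_] /=.
  rewrite addr0 mulrCA [leRHS]mulrC ler_wpM2l // survival_le5 //.
  by rewrite cardsU (t_card th) (t_card tg) hg cards1.
apply: ler_wpDl; first by rewrite mulr_ge0 // exprn_ge0; case/andP: e1.
rewrite mulrCA ler_piMr //; case/andP: d1 => d0 d1; exact: mulr_ile1.
Qed.

(** Given that [x] survives, its load should be near [m = (1 - e) ^+ 2 * load x]. With
    [Q = (1 - e) ^+ 5 * load x ^+ 2], the expanded square is about [Q - 2 * Q + Q], so only the
    errors of order [d] remain. *)
Lemma surviving_load_variance x :
  E (fun A => (L x A - (1 - e) ^+ 2 * load x) ^+ 2 * (surv [set x] A)%:R) <= 60 * d.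
Proof.
set m := _ * load x.
have load_ge0 : 0 <= load x by apply: sumr_ge0.
have e1 : 0 <= 1 - e <= 1 by have := e_le; have := e_gt0; lra.
have -> : E (fun A => (L x A - m) ^+ 2 * (surv [set x] A)%:R) =
    E (fun A => L x A ^+ 2) + (- 2 * m) * E (L x) + m ^+ 2 * survival [set x].
  rewrite -expectZ -[survival _]expect_disjoint -expectZ -!expectD.
  apply: eq_expect => A; have := surviving_load_surv x A.
  case: [disjoint _ & _] => [_|<-]; rewrite /=; ring.
have -> : survival [set x] = 1 - e.
  by rewrite -(bite_prod_point x); apply: eq_bigl => i; rewrite mem_hit1.
have := expect_sqr_surviving_load x; have := expect_surviving_load_ge x.
set Y := E (fun A => _ ^+ 2); set M := E (L x); set q := (1 - e) => hM hY.
have q0 : 0 <= q <= 1 by [].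
pose Q := q ^+ 5 * load x ^+ 2.
have Q1 : Q <= 1.
  by rewrite mulr_ile1 ?exprn_ge0 ?exprn_ile1 //; case/andP: q0.
have mM : Q <= m * M.
  have -> : Q = m * (q ^+ 3 * load x) by rewrite /Q /m -/q; ring.
  by rewrite ler_wpM2l // mulr_ge0 ?exprn_ge0 //; case/andP: q0.
have -> : m ^+ 2 * q = Q by rewrite /Q /m -/q; ring.
(* Since [1 - 25 * d] is at least one half, this crude bound gives [25 * d * Y <= 52 * d]; with the
   [2 * d] of the second moment this stays below [60 * d]. *)
have Y0 : Y <= 2 * (Q + 2 * d).
  have : 0 <= Y; last by move=> Y0; rewrite -/Q in hY; have := d_le; nra.
  by apply: sumr_ge0 => A _; rewrite mulr_ge0 ?sqr_ge0 ?pr_ge0 //; apply: bite_prob_itv.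
rewrite -/Q in hY; have := d_le; have := d_ge0; nra.
Qed.

Variables (c z : R).
Hypotheses (c01 : 0 <= c <= 1) (z_gt0 : 0 < z) (z_le : z <= 2^-1).

(** The load of a surviving point shrinks by about [(1 - e) ^+ 2]. The rescaling undoes this, and
    [1 - z] is a margin for fluctuations. *)
Definition bite_scale : R := (1 - z) / (1 - e) ^+ 2.
Local Notation lam := bite_scale.

Lemma bite_scale_itv : 0 <= lam <= 4.
Proof.
have q0 : 0 < (1 - e) ^+ 2 by rewrite exprn_gt0 //; have := e_le; lra.
rewrite divr_ge0 ?(ltW q0) //=; last by have := z_le; lra.
rewrite ler_pdivrMr //; have := e_le; have := z_gt0; nra.
Qed.

Definition overloaded x A := (1 < lam * L x A)%R.

(** Chebyshev: an overloaded point survives, and its load exceeds the expected value by at least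
    [z / 4]; [960 = 16 * 60]. *)
Lemma overloaded_prob x : E (fun A => (overloaded x A)%:R) <= 960 * d / z ^+ 2.
Proof.
have q0 : 0 < (1 - e) ^+ 2 by rewrite exprn_gt0 //; have := e_le; lra.
have load_ge0 : 0 <= load x by apply: sumr_ge0.
apply: le_trans (_ : 16 / z ^+ 2 * (60 * d) <= _); last first.
  by rewrite le_eqVlt; apply/orP; left; apply/eqP; field; rewrite lt0r_neq0.
apply: le_trans (ler_wpM2l _ (surviving_load_variance x)); last first.
  by rewrite divr_ge0 ?sqr_ge0.
rewrite -expectZ; apply: ler_expect => [i|A]; first exact: bite_prob_itv.
have := surviving_load_surv x A.
rewrite /overloaded; case: ltP => [bx|_ _]; last first.
  by apply: mulr_ge0; [rewrite divr_ge0 ?sqr_ge0 | rewrite mulr_ge0 ?sqr_ge0].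
case: [disjoint _ & _] => [_|L0]; last first.
  by move: bx; rewrite -L0 !mulr0 ltr10.
rewrite mulr1 mulrAC ler_pdivlMr ?exprn_gt0 // mul1r.
move: bx; rewrite /lam mulrAC ltr_pdivlMr // mul1r => bx.
have hm : (1 - e) ^+ 2 * load x <= (1 - e) ^+ 2 by rewrite ler_piMr ?(ltW q0) ?load_le1.
have q4 : 4^-1 <= (1 - e) ^+ 2 by have := e_le; nra.
set m := _ * load x in hm *.
have hL : z * 4^-1 <= L x A - m.
  have L_ge0 : 0 <= L x A by apply: sumr_ge0 => h _; rewrite mulr_ge0.
  have zL : 0 <= z * L x A by rewrite mulr_ge0 ?(ltW z_gt0).
  have Lq : 4^-1 <= L x A by lra.
  have : z * 4^-1 <= z * L x A by rewrite ler_wpM2l ?(ltW z_gt0).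
  by lra.
have z4 : 0 <= z * 4^-1 by rewrite mulr_ge0 ?(ltW z_gt0) // invr_ge0.
have : (z * 4^-1) ^+ 2 <= (L x A - m) ^+ 2.
  by apply: lerXn2r => //; rewrite nnegrE // (le_trans z4).
rewrite exprMn; lra.
Qed.

(** The triples kept by the bite. Chosen singletons also count as obstacles, and [t h != 0] keeps
    them out of the matching. *)
Definition isolated (A : {set {set X}}) : {set {set X}} :=
  [set h : {set X} in A | (t h != 0) && [disjoint A & hit h :\ h]].

Lemma mem_hit (h : {set X}) : t h != 0 -> h \in hit h.
Proof. by move=> /t_card ch; rewrite inE -setI_eq0 setIid -card_gt0 ch. Qed.

(** A triple is chosen with probability [e * t h], and independently nothing else chosen meets it
    with probability at least [survival h]. *)
Lemma expect_card_isolated :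
  e * (1 - e) ^+ 3 * (\sum_h t h) <= E (fun A => #|isolated A|%:R).
Proof.
rewrite [leRHS](_ : _ = \sum_h E (fun A => (h \in isolated A)%:R)); last first.
  rewrite -expect_sum; apply: eq_expect => A.
  by rewrite -sum1_card natr_sum big_mkcond; apply: eq_bigr => h _; case: ifP.
rewrite mulr_sumr; apply: ler_sum => h _.
have [th|th] := eqVneq (t h) 0.
  rewrite th mulr0; apply: sumr_ge0 => A _; apply: mulr_ge0 => //.
  by apply: pr_ge0; apply: bite_prob_itv.
have -> : E (fun A => (h \in isolated A)%:R) =
    E (fun A => ((h \in A) && [disjoint A & hit h :\ h])%:R).
  by apply: eq_expect => A; rewrite inE th.
rewrite expect_mem_disjoint ?inE ?eqxx //.
have -> : p h = e * t h by rewrite /p (t_card th).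
rewrite mulrAC ler_wpM2l ?mulr_ge0 ?(ltW e_gt0) //.
have := survival_ge h; rewrite (t_card th) => /le_trans; apply.
rewrite /survival (big_setD1 h) ?mem_hit //= ler_piMl //.
  by apply: prodr_ge0 => i _; apply: bite_prob1B_ge0.
by rewrite lerBlDr lerDl; case/andP: (bite_prob_itv h).
Qed.

Lemma sum_t_le_card : \sum_h t h <= #|D|%:R.
Proof.
rewrite -sumr_const.
apply: le_trans (_ : \sum_(x in D) \sum_(h : {set X} | x \in h) t h <= _).
  under [leRHS]eq_bigr do rewrite big_mkcond.
  rewrite exchange_big /=; apply: ler_sum => h _.
  have [->|th] := eqVneq (t h) 0; first by rewrite big1 // => x _; case: ifP.
  have [x xh] : exists x, x \in h by apply/set0Pn; rewrite -card_gt0 (t_card th).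
  rewrite (bigD1 x) ?(subsetP (t_sub th)) //= xh lerDl sumr_ge0 // => y _.
  by case: ifP.
by apply: ler_sum => x _; apply: load_le1.
Qed.

(** All triples through an overloaded point are dropped, so that its load becomes zero. *)
Definition residual (A : {set {set X}}) (h : {set X}) : R :=
  if surv h A && [forall x in h, ~~ overloaded x A] then lam * t h else 0.

Lemma residual_itv A h : 0 <= residual A h <= lam * t h.
Proof.
have lam_t : 0 <= lam * t h by rewrite mulr_ge0 //; case/andP: bite_scale_itv.
by rewrite /residual; case: ifP => _; rewrite ?lam_t lexx.
Qed.

Lemma residual_neq0 A h : residual A h != 0 -> t h != 0 /\ surv h A.
Proof.
rewrite /residual; case: ifP => [/andP[-> _]|_]; last by rewrite eqxx.
by rewrite mulf_eq0 negb_or => /andP[_ ->].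
Qed.

Lemma residual_matching (A : {set {set X}}) : fractional_matching3 D (4 * d) (residual A).
Proof.
have /andP[lam0 lam4] := bite_scale_itv.
split=> [h|h /residual_neq0[th _]|x|x y nxy].
- by case/andP: (residual_itv A h).
- by rewrite (t_card th) (t_sub th).
- have [ox|ox] := boolP (overloaded x A).
    rewrite big1 // => h xh; rewrite /residual ifN // negb_and.
    by apply/orP; right; apply/forall_inPn; exists x; rewrite ?negbK.
  apply: le_trans (_ : lam * L x A <= 1); last by rewrite leNgt.
  rewrite mulr_sumr; apply: ler_sum => h xh; rewrite /residual.
  case: (surv h A); rewrite /= ?mulr0 // mulr1; case: ifP => // _.
  by rewrite mulr_ge0.
apply: le_trans (_ : lam * d <= _); last by rewrite ler_wpM2r.
apply: le_trans (ler_wpM2l lam0 (codeg_le nxy)).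
by rewrite mulr_sumr; apply: ler_sum => h _; case/andP: (residual_itv A h).
Qed.

(** Each dropped surviving triple is charged to one of its overloaded points, whose load under [t]
    is at most one. *)
Lemma sum_residual_ge (A : {set {set X}}) :
  lam * \sum_h t h * (surv h A)%:R - lam * \sum_(x in D) (overloaded x A)%:R
    <= \sum_h residual A h.
Proof.
have /andP[lam0 lam4] := bite_scale_itv.
have ov : \sum_h t h * (~~ [forall x in h, ~~ overloaded x A])%:R <=
    \sum_(x in D) (overloaded x A)%:R.
  apply: le_trans (_ : \sum_(x in D) \sum_(h : {set X} | x \in h)
      t h * (overloaded x A)%:R <= _); last first.
    by apply: ler_sum => x _; rewrite -mulr_suml ler_piMl //; apply: load_le1.
  under [leRHS]eq_bigr do rewrite big_mkcond.
  rewrite exchange_big /=; apply: ler_sum => h _.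
  have [->|th] := eqVneq (t h) 0.
    by rewrite mul0r big1 // => x _; rewrite mul0r if_same.
  case: forall_inP => [_|/forall_inP/forall_inPn[x xh]].
    by rewrite mulr0 sumr_ge0 // => x _; case: ifP => // _; rewrite mulr_ge0.
  rewrite negbK => ox; rewrite (bigD1 x) ?(subsetP (t_sub th)) //= xh ox lerDl.
  by rewrite sumr_ge0 // => y _; case: ifP => // _; rewrite mulr_ge0.
apply: le_trans (_ : lam * (\sum_h t h * (surv h A)%:R) -
   lam * (\sum_h t h * (~~ [forall x in h, ~~ overloaded x A])%:R) <= _).
  by rewrite lerD2l lerN2 ler_wpM2l.
rewrite -mulrBr -sumrB mulr_sumr; apply: ler_sum => h _; rewrite /residual.
have lt : 0 <= lam * t h by rewrite mulr_ge0.
by case: (surv h A); case: [forall x in h, _]; rewrite /=; lra.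
Qed.

(** In expectation the bite keeps [e * (1 - e) ^+ 3] of the total weight as triples and leaves about
    [1 - e] of it, worth a factor [c]. The errors are the margin [z] and the overloaded points, with
    [3840 = 4 * 960] as [bite_scale <= 4]. *)
Lemma bite_exists : exists A,
  (c + e * ((1 - e) ^+ 3 - c)) * \sum_h t h - (z + 3840 * d / z ^+ 2) * #|D|%:R
    <= #|isolated A|%:R + c * \sum_h residual A h.
Proof.
have /andP[lam0 lam4] := bite_scale_itv; have /andP[c0 c1] := c01.
have sumt := sum_t_le_card.
have sumt0 : 0 <= \sum_h t h by apply: sumr_ge0.
have q0 : 0 < 1 - e by have := e_le; lra.
pose F (A : {set {set X}}) := #|isolated A|%:R + c *
  (lam * \sum_h t h * (surv h A)%:R + -1 * (lam * \sum_(x in D) (overloaded x A)%:R)).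
have [|A hA] := @expect_attained R _ p bite_prob_itv
   ((c + e * ((1 - e) ^+ 3 - c)) * (\sum_h t h) - (z + 3840 * d / z ^+ 2) * #|D|%:R) F;
  last first.
  exists A; apply: le_trans hA _; rewrite lerD2l ler_wpM2l //.
  by rewrite mulN1r sum_residual_ge.
rewrite expectD expectZ expectD !expectZ !expect_sum.
have h1 := expect_card_isolated.
have h2 : (1 - e) ^+ 3 * (\sum_h t h) <= \sum_h E (fun A => t h * (surv h A)%:R).
  rewrite mulr_sumr; apply: ler_sum => h _; rewrite expectZ expect_disjoint mulrC.
  have [->|th] := eqVneq (t h) 0; first by rewrite !mul0r.
  by rewrite ler_wpM2l // -(t_card th) survival_ge.
have h3 : \sum_(x in D) E (fun A => (overloaded x A)%:R) <= 960 * d / z ^+ 2 * #|D|%:R.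
  rewrite mulr_natr -sumr_const; apply: ler_sum => x _; exact: overloaded_prob.
have h4 : lam * (960 * d / z ^+ 2 * #|D|%:R) <= 3840 * d / z ^+ 2 * #|D|%:R.
  rewrite [leRHS](_ : _ = 4 * (960 * d / z ^+ 2 * #|D|%:R)); last by ring.
  by rewrite ler_wpM2r // mulr_ge0 // divr_ge0 ?sqr_ge0 // mulr_ge0.
have {}h2 : (1 - z) * (1 - e) * (\sum_h t h) <=
    lam * \sum_h E (fun A => t h * (surv h A)%:R).
  apply: le_trans (ler_wpM2l lam0 h2); rewrite /lam le_eqVlt; apply/orP; left.
  by apply/eqP; field; rewrite lt0r_neq0.
have {}h3 := le_trans (ler_wpM2l lam0 h3) h4.
set S := \sum_h t h in sumt sumt0 h1 h2 *.
set B := 3840 * d / z ^+ 2 * #|D|%:R in h3 *.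
have B0 : 0 <= B by rewrite /B mulr_ge0 // divr_ge0 ?sqr_ge0 // mulr_ge0.
rewrite [X in _ - X]mulrDl -/B.
set U := lam * _ in h2 *; set W := lam * _ in h3 *.
have h5 : c * ((1 - z) * (1 - e) * S - B) <= c * (U + -1 * W).
  by rewrite ler_wpM2l //; lra.
have h6 : c * B <= B by rewrite ler_piMl.
have h7 : c * (z * (1 - e) * S) <= z * #|D|%:R.
  apply: le_trans (_ : z * (1 - e) * S <= _).
    by rewrite ler_piMl // !mulr_ge0 ?(ltW z_gt0) ?(ltW q0).
  rewrite -mulrA ler_wpM2l ?(ltW z_gt0) // (le_trans _ sumt) // ler_piMl //.
  by have := e_gt0; lra.
lra.
Qed.

End Bite.

(** The ratio [c] is achievable for small codegrees. The threshold [d] is uniform in the hypergraph,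
    and the error is measured in points because a bite loses weight at overloaded points. *)
Definition near_matching (R : realFieldType) (c : R) :=
  forall eta : R, 0 < eta -> exists2 d : R, 0 < d &
  forall (X : finType) (D : {set X}) (t : {set X} -> R),
    fractional_matching3 D d t -> exists M : {set {set X}},
    [/\ trivIset M, forall h, h \in M -> t h != 0 &
        c * (\sum_h t h) - eta * #|D|%:R <= #|M|%:R].

(** * Iterating the bite *)

Section Nibble.
Variable R : realFieldType.

Lemma fractional_matching3W (X : finType) (D : {set X}) (d d' : R) t :
  d <= d' -> fractional_matching3 D d t -> fractional_matching3 D d' t.
Proof.
by move=> dd' [t0 tc tl td]; split=> // x y /td /le_trans; apply.
Qed.

Lemma sum_fractional_matching3_ge0 (X : finType) (D : {set X}) (d : R) t :
  fractional_matching3 D d t -> 0 <= \sum_h t h.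
Proof. by case=> t0 _ _ _; apply: sumr_ge0. Qed.

Lemma near_matching0 : near_matching (0 : R).
Proof.
move=> eta eta0; exists 1 => [|X D t _]; first exact: ltr01.
exists set0; split=> [|h|]; rewrite ?inE //.
  by apply/trivIsetP => A B; rewrite inE.
by rewrite cards0 mul0r sub0r oppr_le0 mulr_ge0 ?(ltW eta0).
Qed.

Lemma near_matchingW (c c' : R) : c' <= c -> near_matching c -> near_matching c'.
Proof.
move=> cc' nmc eta eta0; have [d d0 dP] := nmc eta eta0.
exists d => // X D t tP; have [M [tM Mt hM]] := dP X D t tP.
exists M; split=> //; apply: le_trans hM; rewrite lerD2r ler_wpM2r //.
exact: sum_fractional_matching3_ge0 tP.
Qed.

(** The isolated triples of a bite are joined to a matching of the residual, whose triples avoid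
    every chosen set. *)
Lemma near_matching_bite (c e : R) : 0 <= c <= 1 -> 0 < e -> e <= 2^-1 ->
  near_matching c -> near_matching (c + e * ((1 - e) ^+ 3 - c)).
Proof.
move=> c01 e0 e1 nmc eta eta0.
have [|d1 d1_gt0 d1P] := nmc (eta / 2); first by rewrite divr_gt0.
pose z := Num.min (eta / 4) 2^-1.
have z_gt0 : 0 < z by rewrite lt_min divr_gt0 //= invr_gt0.
have z_eta : z <= eta / 4 by rewrite ge_min lexx.
have z_le : z <= 2^-1 by rewrite ge_min lexx orbT.
(* The three bounds serve the bite, the residual codegrees [4 * d], and the overloaded points. The
   total error is [eta / 4] from [z], [eta / 4] from overloading and [eta / 2] from the residual. *)
pose d := Num.min 50^-1 (Num.min (d1 / 4) (eta / 4 * z ^+ 2 / 3840)).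
have z2_gt0 : 0 < eta / 4 * z ^+ 2 by rewrite mulr_gt0 ?exprn_gt0 // divr_gt0.
have d_gt0 : 0 < d by rewrite !lt_min invr_gt0 ltr0n !divr_gt0.
have d_le : d <= 50^-1 by rewrite ge_min lexx.
have d_d1 : 4 * d <= d1.
  have : d <= d1 / 4 by rewrite !ge_min lexx /= orbT.
  by rewrite ler_pdivlMr // mulrC.
have d_eta : 3840 * d / z ^+ 2 <= eta / 4.
  rewrite ler_pdivrMr ?exprn_gt0 //.
  have : d <= eta / 4 * z ^+ 2 / 3840 by rewrite !ge_min lexx !orbT.
  by rewrite ler_pdivlMr // mulrC.
exists d => // X D t tP.
have [A hA] := bite_exists tP (ltW d_gt0) d_le e0 e1 c01 z_gt0 z_le.
have [M [tM Mt hM]] := d1P X D _ (fractional_matching3W d_d1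
  (residual_matching tP (ltW d_gt0) e1 z_gt0 z_le A)).
have MA h g : h \in M -> g \in A -> [disjoint g & h].
  move=> /Mt/residual_neq0[_ sh] gA; have := disjointFr sh gA.
  by rewrite inE => /negbFE.
have isoD h g : h \in isolated t A -> g \in A -> g != h -> [disjoint g & h].
  rewrite inE => /and3P[_ _ dh] gA ngh; have := disjointFr dh gA.
  by rewrite !inE ngh => /negbFE.
have isoA g : g \in isolated t A -> g \in A by rewrite inE => /andP[].
have tN h : h \in isolated t A -> t h != 0 by rewrite inE => /and3P[].
exists (isolated t A :|: M); split.
- apply/trivIsetP => g h; rewrite !in_setU => /orP[gI|gM] /orP[hI|hM'] ngh.
  + exact: isoD hI (isoA _ gI) ngh.
  + exact: MA hM' (isoA _ gI).
  + by rewrite disjoint_sym; apply: MA gM (isoA _ hI).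
  + exact: (trivIsetP tM).
- by move=> h; rewrite in_setU => /orP[/tN //|/Mt/residual_neq0[]].
have -> : #|isolated t A :|: M|%:R = #|isolated t A|%:R + #|M|%:R :> R.
  rewrite cardsU [_ :&: _](_ : _ = set0) ?cards0 ?subn0 ?natrD //.
  apply/setP => h; rewrite in_set0 in_setI; apply/andP => -[hI hM'].
  have [_ cT _ _] := tP; have := MA h h hM' (isoA _ hI).
  by rewrite -setI_eq0 setIid => /eqP h0; have [] := cT _ (tN _ hI); rewrite h0 cards0.
have D0 : 0 <= #|D|%:R :> R by [].
move: (3840 * d / z ^+ 2) d_eta hA => b b_eta hA.
have : (z + b) * #|D|%:R <= eta / 2 * #|D|%:R.
  by rewrite ler_wpM2r //; lra.
lra.
Qed.

End Nibble.

Lemma near_matching_lt1 (R : archiRealFieldType) (g : R) : 0 < g -> near_matching (1 - g).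
Proof.
move=> g0; pose e := Num.min (g / 6) 2^-1.
have e0 : 0 < e by rewrite lt_min divr_gt0 //= invr_gt0.
have e_g : e <= g / 6 by rewrite ge_min lexx.
have e1 : e <= 2^-1 by rewrite ge_min lexx orbT.
(* The map [c -> c + e * (a - c)] fixes [a] and contracts distances to it by [1 - e]. Starting from
   [0], the ratio after [k] bites is [a * (1 - (1 - e) ^+ k)]. *)
pose a := (1 - e) ^+ 3.
have a_ge : 1 - g / 2 <= a by rewrite /a; nra.
have q0 : 0 <= 1 - e by lra.
have q1 : 1 - e <= 1 by lra.
have pw_itv k : 0 <= (1 - e) ^+ k <= 1 by rewrite exprn_ge0 ?exprn_ile1.
have /andP[a0 a1] : 0 <= a <= 1 := pw_itv 3%N.
have nm k : near_matching (a * (1 - (1 - e) ^+ k)).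
  elim: k => [|k IHk]; first by rewrite expr0 subrr mulr0; apply: near_matching0.
  rewrite [a * _](_ : _ = a * (1 - (1 - e) ^+ k) +
    e * ((1 - e) ^+ 3 - a * (1 - (1 - e) ^+ k))); last by rewrite -/a exprS; ring.
  apply: near_matching_bite => //; have /andP[h1 h2] := pw_itv k.
  have k0 : 0 <= 1 - (1 - e) ^+ k by lra.
  have k1 : 1 - (1 - e) ^+ k <= 1 by lra.
  by rewrite mulr_ge0 // mulr_ile1.
(* A Bernoulli-type bound that makes the geometric decay explicit: [k * e >= 2 / g] suffices. *)
have pw k : (1 - e) ^+ k * (1 + k%:R * e) <= 1.
  elim: k => [|k IHk]; first by rewrite expr0 mul0r addr0 mulr1.
  apply: le_trans IHk; rewrite exprSr -mulrA ler_wpM2l //; first by case/andP: (pw_itv k).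
  rewrite -natr1; have k0 : 0 <= k%:R :> R by []; nra.
have [k hk] : exists k : nat, 2 / g <= k%:R * e.
  exists (Num.bound (2 / g / e)); rewrite -ler_pdivrMr // ltW // archi_boundP //.
  by rewrite !divr_ge0 ?(ltW g0) ?(ltW e0).
apply: near_matchingW (nm k).
have pk : (1 - e) ^+ k <= g / 2.
  have := pw k; have /andP[h1 h2] := pw_itv k.
  move: hk; rewrite ler_pdivrMr // => hk hp; nra.
have /andP[h1 h2] := pw_itv k; nra.
Qed.

(** * Triangle packings of graphs *)

Lemma card_set3 (T : finType) (x y z : T) : x != y -> y != z -> x != z -> #|[set x; y; z]| = 3%N.
Proof.
by move=> nxy nyz nxz; rewrite setUC cardsU1 !inE cards2 nxy negb_or eq_sym nxz eq_sym nyz.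
Qed.

Section CliqueEdges.
Variable T : finType.
Implicit Types (A B C : {set T}).

Lemma mem_clique_edges A C : (A \in clique_edges C) = (A \subset C) && (#|A| == 2%N).
Proof. by rewrite !inE. Qed.

Lemma card_clique_edges C : #|C| = 3%N -> #|clique_edges C| = 3%N.
Proof.
move=> cC; rewrite -[RHS]/'C(3, 2) -cC -cards_draws.
by apply: eq_card => A; rewrite !inE.
Qed.

Lemma clique_edges2 A : #|A| = 2%N -> clique_edges A = [set A].
Proof.
move=> cA; apply/setP => B; rewrite mem_clique_edges inE.
apply/andP/eqP => [[BA /eqP cB]|->]; last by rewrite cA.
by apply/eqP; rewrite eqEcard BA cA cB.
Qed.

(** Two distinct edges determine the triangle: this gives injectivity of [clique_edges] and the
    small codegrees. *)
Lemma clique_edges_setU A B C : A \in clique_edges C -> B \in clique_edges C ->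
  #|C| = 3%N -> A != B -> C = A :|: B.
Proof.
rewrite !mem_clique_edges => /andP[AC /eqP cA] /andP[BC /eqP cB] cC nAB.
apply/eqP; rewrite eq_sym eqEcard subUset AC BC cC.
rewrite ltnNge; apply: contra nAB => UA2.
have /eqP eA : A == A :|: B by rewrite eqEcard subsetUl cA.
have /eqP eB : B == A :|: B by rewrite eqEcard subsetUr cB.
by apply/eqP; apply: etrans eA (esym eB).
Qed.

Lemma clique_edges_inj3 C C' :
  #|C| = 3%N -> #|C'| = 3%N -> clique_edges C = clique_edges C' -> C = C'.
Proof.
move=> cC cC' eCC'.
have /card_gt1P[A [B [AC BC nAB]]] : (1 < #|clique_edges C|)%N.
  by rewrite card_clique_edges.
by rewrite (clique_edges_setU AC BC) // (@clique_edges_setU A B C') // -eCC'.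
Qed.

Lemma clique_edges_set3 (x y z : T) : x != y -> y != z -> x != z ->
  clique_edges [set x; y; z] = [set [set x; y]; [set y; z]; [set x; z]].
Proof.
move=> nxy nyz nxz; apply/eqP; rewrite eq_sym eqEcard; apply/andP; split.
  apply/subsetP => A; rewrite mem_clique_edges !inE.
  by move=> /orP[/orP[]|] /eqP->; rewrite cards2 ?nxy ?nyz ?nxz eqxx andbT;
    apply/subsetP => v; rewrite !inE => /orP[] ->; rewrite ?orbT.
rewrite (card_clique_edges (card_set3 nxy nyz nxz)) card_set3 //.
- by apply/eqP => /setP/(_ x); rewrite !inE eqxx (negPf nxy) (negPf nxz).
- by apply/eqP => /setP/(_ y); rewrite !inE eqxx (negPf nyz) eq_sym (negPf nxy).
- by apply/eqP => /setP/(_ y); rewrite !inE eqxx (negPf nyz) eq_sym (negPf nxy).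
Qed.

End CliqueEdges.

(** * Decompositions from triangle packings *)

Section TrianglePacking.
Variables (T : finType) (G : sgraph T).
Implicit Types (A B C : {set T}).

Definition triangles : {set {set T}} := [set C | complete_subgraph G C & #|C| == 3%N].

(** The 3-uniform hypergraph on the edges of [G] to which the nibble is applied. *)
Definition triangle_edge_sets : {set {set {set T}}} := [set clique_edges C | C in triangles].

Lemma triangleP C : reflect ((forall x y, x \in C -> y \in C -> x != y -> adj G x y)
  /\ #|C| = 3%N) (C \in triangles).
Proof.
rewrite inE; apply: (iffP andP) => [[cG /eqP cC]|[cG cC]]; split=> //; last exact/eqP.
  by move=> x y xC yC nxy; have /forall_inP/(_ x xC)/forall_inP/(_ y yC)/implyP := cG; apply.
by apply/forall_inP => x xC; apply/forall_inP => y yC; apply/implyP => nxy; apply: cG.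
Qed.

Lemma adj_neq x y : adj G x y -> x != y.
Proof. by apply: contraTneq => ->; rewrite adj_irrefl. Qed.

Lemma edgesP A :
  reflect (exists x y, adj G x y /\ A = [set x; y]) (A \in edges G).
Proof.
apply: (iffP imsetP) => [[[x y]]|[x [y [xy ->]]]].
  by rewrite inE /= => xy ->; exists x, y.
by exists (x, y); rewrite ?inE.
Qed.

Lemma card_edge A : A \in edges G -> #|A| = 2%N.
Proof. by case/edgesP=> x [y [xy ->]]; rewrite cards2 adj_neq. Qed.

Lemma clique_edges_sub C : complete_subgraph G C -> clique_edges C \subset edges G.
Proof.
move=> cC; apply/subsetP => A; rewrite mem_clique_edges => /andP[AC /cards2P[x [y [nxy AE]]]].
apply/edgesP; exists x, y; split=> //.
have xC : x \in C by rewrite (subsetP AC) // AE !inE eqxx.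
have yC : y \in C by rewrite (subsetP AC) // AE !inE eqxx orbT.
by have /forall_inP/(_ x xC)/forall_inP/(_ y yC)/implyP := cC; apply.
Qed.

Lemma triangle_edge_setsP h : h \in triangle_edge_sets ->
  exists C, [/\ C \in triangles, h = clique_edges C, #|h| = 3%N & h \subset edges G].
Proof.
case/imsetP=> C Ct ->; exists C; split=> //.
  by apply: card_clique_edges; case/triangleP: Ct.
by apply: clique_edges_sub; move: Ct; rewrite inE => /andP[].
Qed.

Lemma complete_edge A : A \in edges G -> complete_subgraph G A.
Proof.
case/edgesP=> x [y [xy ->]]; apply/forall_inP => u; rewrite !inE => ux.
apply/forall_inP => v; rewrite !inE => vx; apply/implyP.
by case/orP: ux => /eqP->; case/orP: vx => /eqP->; rewrite ?eqxx // adj_sym.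
Qed.

(** The packed triangles and the uncovered edges decompose [G] with weight
    [3 * #|M| + 2 * (#|edges G| - 3 * #|M|)]. The additive form avoids truncated subtraction. *)
Lemma pi3_le_packing (M : {set {set {set T}}}) :
  trivIset M -> M \subset triangle_edge_sets -> (pi3 G + 3 * #|M| <= 2 * #|edges G|)%N.
Proof.
move=> tM /subsetP MH.
pose D1 := [set C in triangles | clique_edges C \in M].
pose D2 := edges G :\: cover M.
have cov_sub : cover M \subset edges G.
  by apply/bigcupsP => h /MH/triangle_edge_setsP[C []].
have card_cov : #|cover M| = (3 * #|M|)%N.
  have /eqP <- := tM; rewrite mulnC -sum_nat_const; apply: eq_bigr => h /MH.
  by case/triangle_edge_setsP=> C [].
have imD1 : [set clique_edges C | C in D1] = M.
  apply/setP => h; apply/imsetP/idP => [[C] |hM].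
    by rewrite inE => /andP[_ CM] ->.
  by have [C [Ct hE _ _]] := triangle_edge_setsP (MH h hM); exists C; rewrite // inE Ct -hE.
have D1c C : C \in D1 -> #|C| = 3%N by rewrite inE => /andP[/triangleP[]].
have D2c C : C \in D2 -> #|C| = 2%N by rewrite inE => /andP[_ /card_edge].
have cD1 : #|D1| = #|M|.
  by rewrite -imD1 card_in_imset // => C C' /D1c ? /D1c ?; apply: clique_edges_inj3.
have D12 : [disjoint D1 & D2].
  rewrite -setI_eq0; apply/eqP/setP => C; rewrite in_set0 in_setI.
  by apply/andP => -[/D1c c3 /D2c]; rewrite c3.
have imD2 : [set clique_edges C | C in D2] = [set [set A] | A in D2].
  by apply: eq_in_imset => A /D2c; apply: clique_edges2.
have wt : decomposition3_weight G (3 * #|M| + 2 * #|D2|)%N.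
  apply/existsP; exists (D1 :|: D2); apply/andP; split; last first.
    rewrite (eq_bigl [predU D1 & D2]) => [|C]; last by rewrite in_setU.
    rewrite bigU //= (eq_bigr (fun=> 3%N)) => [|C /D1c //].
    rewrite [X in (_ + X)%N](eq_bigr (fun=> 2%N)) => [|C /D2c //].
    by rewrite !sum_nat_const cD1 ![(_ * #|_|)%N]mulnC.
  apply/andP; split.
    apply/forall_inP => C; rewrite in_setU => /orP[|CD2]; last first.
      by rewrite (D2c _ CD2) eqxx andbT complete_edge //; move: CD2; rewrite inE => /andP[].
    by rewrite inE => /andP[]; rewrite inE => /andP[-> ->] _; rewrite orbT.
  rewrite imsetU imD1 imD2; apply/and3P; split.
  - rewrite /cover bigcup_setU -/(cover M) -/(cover _) cover_imset.
    rewrite (_ : \bigcup_(A in D2) [set A] = D2).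
      apply/eqP/setP => A; rewrite in_setU in_setD.
      by case: (boolP (A \in cover M)) => // AM; rewrite (subsetP cov_sub).
    by apply/setP => A; apply/bigcupP/idP => [[B BD /set1P->]|AD] //; exists A; rewrite ?set11.
  - apply/trivIsetP => h g; rewrite !in_setU => hM gM nhg.
    case/orP: hM gM => [hM|/imsetP[A AD hE]] /orP[gM|/imsetP[B BD gE]].
    + exact: (trivIsetP tM).
    + rewrite gE disjoint_sym disjoints1; move: BD; rewrite inE => /andP[BM _].
      by apply: contra BM => Bh; apply/bigcupP; exists h.
    + rewrite hE disjoints1; move: AD; rewrite inE => /andP[AM _].
      by apply: contra AM => Ag; apply/bigcupP; exists g.
    + by rewrite hE disjoints1 gE inE; apply: contra nhg => /eqP AB; rewrite hE gE AB.
  - rewrite in_setU negb_or; apply/andP; split.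
      by apply/negP => /MH/triangle_edge_setsP[C [_ _]]; rewrite cards0.
    by apply/imsetP => -[A _ /setP/(_ A)]; rewrite !inE eqxx.
have : (pi3 G <= 3 * #|M| + 2 * #|D2|)%N by rewrite /pi3; case: ex_minnP => m _; apply.
have : #|D2| = (#|edges G| - 3 * #|M|)%N by rewrite cardsD (setIidPr cov_sub) card_cov.
have := subset_leq_card cov_sub; rewrite card_cov; lia.
Qed.

End TrianglePacking.

(** * Fractional triangle packings *)

Section FractionalPacking.
Variables (R : realFieldType) (T : finType) (G : sgraph T).

Lemma sum_adj (F : {set T} -> R) :
  \sum_x \sum_y (if adj G x y then F [set x; y] else 0) = 2 * \sum_(A in edges G) F A.
Proof.
rewrite pair_big /= -big_mkcond /=.
rewrite (partition_big (fun q => [set q.1; q.2]) (mem (edges G))) /= => [|[x y] /= xy].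
  rewrite mulr_sumr; apply: eq_bigr => A /edgesP[a [b [ab AE]]].
  rewrite (eq_bigr (fun=> F A)) => [|q /andP[_ /eqP->] //].
  rewrite sumr_const mulr_natl; congr (_ *+ _).
  have nab := adj_neq ab.
  rewrite [LHS](_ : _ = #|[set (a, b); (b, a)]|).
    by rewrite cards2 xpair_eqE (negPf nab).
  apply: eq_card => -[x y]; rewrite !inE AE !xpair_eqE /=; apply/andP/orP.
    case=> xy /eqP/setP sE.
    have := sE x; have := sE y; rewrite !inE !eqxx ?orbT /=.
    have nxy := adj_neq xy.
    move=> /esym/orP[]/eqP yE /esym/orP[]/eqP xE; move: nxy; rewrite xE yE ?eqxx //.
      by right.
    by left.
  case=> /andP[/eqP-> /eqP->]; first by rewrite ab.
  by rewrite adj_sym ab setUC.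
by apply/edgesP; exists x, y.
Qed.

Definition adj3 x y z := [&& adj G x y, adj G y z & adj G x z].

Lemma triangle_adj3 x y z : adj3 x y z -> [set x; y; z] \in triangles G.
Proof.
case/and3P=> xy yz xz; apply/triangleP; split; last by rewrite card_set3 ?(@adj_neq _ G).
move=> u v; rewrite !inE => /orP[/orP[]|] /eqP-> /orP[/orP[]|] /eqP->.
all: by rewrite ?eqxx // adj_sym.
Qed.

(** A crude count: the ordered triples spanning [C] lie in its cube, of size [27]. *)
Lemma sum_adj3_le (F : {set T} -> R) : (forall C, 0 <= F C) ->
  \sum_x \sum_y \sum_z (if adj3 x y z then F [set x; y; z] else 0)
    <= 27 * \sum_(C in triangles G) F C.
Proof.
move=> F0; rewrite pair_big /= pair_big /=.
apply: le_trans (_ : \sum_(q : T * T * T) \sum_(C in triangles G)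
  (if q \in setX (setX C C) C then F C else 0) <= _).
  apply: ler_sum => -[[x y] z] _ /=; case: ifP => [/triangle_adj3 tr|_].
    rewrite (bigD1 [set x; y; z]) //= ifT; last by rewrite !inE !eqxx ?orbT.
    by rewrite lerDl sumr_ge0 // => C _; case: ifP.
  by rewrite sumr_ge0 // => C _; case: ifP.
rewrite exchange_big mulr_sumr /=; apply: ler_sum => C /triangleP[_ cC].
by rewrite -big_mkcond sumr_const !cardsX cC mulr_natl.
Qed.

Lemma sum_triangle_edge_sets (F : {set {set T}} -> R) :
  \sum_(h in triangle_edge_sets G) F h = \sum_(C in triangles G) F (clique_edges C).
Proof.
rewrite big_imset // => C C' /triangleP[_ cC] /triangleP[_ cC'].
exact: clique_edges_inj3.
Qed.

(** [weighted_mantel] with [u = 2 - 3 * w] on edges, slack [3 * s] on triangles and [K = k * #|T|].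
    The slack term has coefficient [81 / K], and dividing by six gives [27 / (2 * K)]. *)
Lemma triangle_cover_bound (k : R) (w : {set T} -> R) (s : {set {set T}} -> R) :
    0 < k -> (0 < #|T|)%N -> (forall e, 0 <= w e) -> (forall h, 0 <= s h) ->
    (forall h, h \in triangle_edge_sets G -> 1 <= \sum_(e in h) w e + s h) ->
  (2 * #|edges G|%:R - (1 + k) * #|T|%:R ^+ 2 / 2) / 3 <=
  \sum_(e in edges G) w e
    + 27 / (2 * k * #|T|%:R) * \sum_(h in triangle_edge_sets G) s h.
Proof.
move=> k0 T0 w0 s0 cov.
pose u x y := if adj G x y then 2 - 3 * w [set x; y] else 0.
pose sg x y z := if adj3 x y z then 3 * s (clique_edges [set x; y; z]) else 0.
have n0 : 0 < #|T|%:R :> R by rewrite ltr0n.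
have := @weighted_mantel R T u sg (k * #|T|%:R).
have -> : \sum_x \sum_y u x y = 2 * (2 * #|edges G|%:R - 3 * \sum_(e in edges G) w e).
  rewrite (sum_adj (fun e => 2 - 3 * w e)) sumrB sumr_const -mulr_sumr mulr_natr; ring.
have sgle : \sum_x \sum_y \sum_z sg x y z <=
    81 * \sum_(h in triangle_edge_sets G) s h.
  rewrite sum_triangle_edge_sets.
  apply: le_trans (sum_adj3_le (F := fun C => 3 * s (clique_edges C)) _) _ => [C|].
    by rewrite mulr_ge0.
  by rewrite -mulr_sumr mulrA -natrM.
have u_sym x y : u x y = u y x by rewrite /u adj_sym setUC.
have u_diag x : u x x = 0 by rewrite /u adj_irrefl.
have u_le2 x y : u x y <= 2.
  rewrite /u; case: ifP => // _; by rewrite gerBl mulr_ge0.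
have sg_ge0 x y z : 0 <= sg x y z by rewrite /sg; case: ifP => // _; rewrite mulr_ge0.
have u_sg x y z : 1 <= u x y -> u x z + u y z <= 2 + sg x y z.
  move=> uxy; case: (boolP (adj3 x y z)) => [tr|ntr].
    have /and3P[xy yz xz] := tr.
    have := cov (clique_edges [set x; y; z]).
    rewrite (imset_f _ (triangle_adj3 tr)) => /(_ isT).
    have e3 : clique_edges [set x; y; z] = [set x; z] |: ([set x; y] |: [set [set y; z]]).
      by rewrite clique_edges_set3 ?(@adj_neq _ G) // setUC.
    have [nxy nyz nxz] : [/\ x != y, y != z & x != z] by rewrite !(@adj_neq _ G).
    rewrite {1}e3 !big_setU1 /= ?big_set1 ?inE.
    - move: uxy; rewrite /u /sg tr xy yz xz; lra.
    - by apply/eqP => /setP/(_ x); rewrite !inE eqxx (negPf nxy) (negPf nxz).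
    - rewrite negb_or; apply/andP; split.
        by apply/eqP => /setP/(_ y); rewrite !inE eqxx (negPf nyz) eq_sym (negPf nxy).
      by apply/eqP => /setP/(_ x); rewrite !inE eqxx (negPf nxy) (negPf nxz).
  (* Outside triangles one of the two pairs is not an edge and has [u = 0]. *)
  have := u_le2 x z; have := u_le2 y z; have := sg_ge0 x y z.
  have axy : adj G x y by move: uxy; rewrite /u; case: ifP => // _; rewrite ler10.
  move: ntr; rewrite /adj3 axy /= negb_and => /orP[] /negPf nadj.
    by rewrite [u y z]/u nadj; lra.
  by rewrite [u x z]/u nadj; lra.
have K0 : 0 < k * #|T|%:R by rewrite mulr_gt0.
move=> /(_ u_sym u_diag u_le2 sg_ge0 u_sg (ltW K0) K0) mantel.
set W := \sum_(e in edges G) w e in mantel *.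
set S := \sum_(h in _) s h in sgle *.
have {}sgle : (\sum_x \sum_y \sum_z sg x y z) / (k * #|T|%:R) <=
    6 * (27 / (2 * k * #|T|%:R) * S).
  rewrite ler_pdivrMr // (le_trans sgle) // le_eqVlt; apply/orP; left; apply/eqP.
  by field; rewrite !lt0r_neq0.
rewrite ler_pdivrMr //; move: (27 / _ * S) sgle => dS sgle.
have := le_trans mantel (lerD (lexx _) sgle); lra.
Qed.

Lemma card_edges_le : (#|edges G| <= #|T| ^ 2)%N.
Proof.
by rewrite (leq_trans (leq_imset_card _ _)) // (leq_trans (max_card _)) // card_prod expnS expn1.
Qed.

(** Two distinct edges lie in at most one common triangle, so a codegree is a single weight and the
    cap of the duality bounds it. *)
Lemma fractional_triangle_packing (k : R) : 0 < k -> (0 < #|T|)%N ->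
  exists t : {set {set T}} -> R,
  [/\ fractional_matching3 (edges G) (27 / (2 * k * #|T|%:R)) t,
      forall h, t h != 0 -> h \in triangle_edge_sets G &
      (2 * #|edges G|%:R - (1 + k) * #|T|%:R ^+ 2 / 2) / 3 <= \sum_h t h].
Proof.
move=> k0 T0; set d := 27 / _; set b := _ / 3.
have d0 : 0 <= d by rewrite divr_ge0 // !mulr_ge0 // ltW.
have [w s w0 s0 cov|h /triangle_edge_setsP[C []] //|t [td tH tl tb]] :=
  @capped_packing_duality R _ (edges G) (triangle_edge_sets G) d b d0.
  exact: triangle_cover_bound.
have tH' h : t h != 0 -> h \in triangle_edge_sets G.
  by apply: contraR => /tH->.
exists t; split=> //; split=> [h|h /tH'/triangle_edge_setsP[C []]//|//|A B nAB].
  by case/andP: (td h).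
case: (pickP [pred h : {set {set T}} | [&& A \in h, B \in h & t h != 0]]) => [h|noh].
  case/and3P=> Ah Bh th; rewrite (bigD1 h) ?Ah //= big1 ?addr0 => [|g].
    by case/andP: (td h).
  case/andP=> /andP[Ag Bg]; apply: contraNeq => tg.
  have [C [/triangleP[_ cC] hE _ _]] := triangle_edge_setsP (tH' _ th).
  have [C' [/triangleP[_ cC'] gE _ _]] := triangle_edge_setsP (tH' _ tg).
  rewrite hE gE in Ah Bh Ag Bg *.
  by rewrite (clique_edges_setU Ah Bh) // (clique_edges_setU Ag Bg).
rewrite big1 // => h /andP[Ah Bh]; apply/eqP/negPn/negP => th.
by have := noh h; rewrite /= Ah Bh th.
Qed.

End FractionalPacking.

(** * The asymptotic bound *)

Lemma pi3_asymptotic (R : archiRealFieldType) (eps : R) : 0 < eps ->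
  (* Half of [eps] is spent on the packing bound with [k = eps], the other half on the nibble, whose
     loss is at most [6 * g * #|T| ^+ 2]. *)
  exists n0 : nat, forall (T : finType) (G : sgraph T), (n0 <= #|T|)%N ->
    (pi3 G)%:R <= #|T|%:R ^+ 2 / 2 + eps * #|T|%:R ^+ 2.
Proof.
move=> eps0; pose g := eps / 12.
have g0 : 0 < g by rewrite divr_gt0.
have [d d0 dP] := near_matching_lt1 g0 g0.
exists (Num.bound (27 / (2 * eps) / d)).+1 => T G nT.
have T0 : (0 < #|T|)%N by apply: leq_trans nT.
have n0 : 0 < #|T|%:R :> R by rewrite ltr0n.
have dT : 27 / (2 * eps * #|T|%:R) <= d.
  rewrite invfM mulrA ler_pdivrMr // -ler_pdivrMl // mulrC.
  apply: le_trans (_ : (Num.bound (27 / (2 * eps) / d))%:R <= _).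
    by rewrite ltW // archi_boundP // !divr_ge0 ?mulr_ge0 // ltW.
  by rewrite ler_nat ltnW.
have [t [tP tH tb]] := fractional_triangle_packing G eps0 T0.
have tP' := fractional_matching3W dT tP.
have [M [tM Mt hM]] := dP _ _ _ tP'.
have MH : M \subset triangle_edge_sets G by apply/subsetP => h /Mt/tH.
have := pi3_le_packing tM MH; rewrite -(ler_nat R) natrD !natrM => piM.
have tE := sum_t_le_card tP.
have : #|edges G|%:R <= #|T|%:R ^+ 2 :> R.
  by rewrite -natrX ler_nat card_edges_le.
have gE : g * (\sum_h t h) <= g * #|edges G|%:R by rewrite ler_wpM2l // ltW.
rewrite -(ler_pM2l g0) => gT.
move: tb; rewrite ler_pdivrMr // => tb.
have eg : eps = 12 * g by rewrite /g; field.
rewrite eg in tb *; lra.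
Qed.

Lemma pi3_le_sqr (T : finType) (G : sgraph T) : (pi3 G <= 2 * #|T| ^ 2)%N.
Proof.
have tr0 : trivIset (set0 : {set {set {set T}}}).
  by apply/trivIsetP => A B; rewrite inE.
have := pi3_le_packing tr0 (sub0set _ : _ \subset triangle_edge_sets G).
rewrite cards0 muln0 addn0 => /leq_trans; apply.
by rewrite leq_mul2l card_edges_le.
Qed.

From mathcomp Require Import all_classical all_reals all_analysis.
Import Order.TTheory GRing.Theory Num.Theory numFieldNormedType.Exports.
Local Open Scope classical_set_scope.
Local Open Scope ring_scope.

Theorem theorem7 (R : realType) :
  exists f : nat -> R,
    f =o_\oo (fun n : nat => n%:R ^+ 2 : R) /\
    forall (n : nat) (T : finType) (G : sgraph T), #|T| = n ->
      (pi3 G)%:R <= n%:R ^+ 2 / 2 + f n.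
Proof.
pose excess n : set R := [set r | r = 0 \/ exists (T : finType) (G : sgraph T),
  #|T| = n /\ r = (pi3 G)%:R - n%:R ^+ 2 / 2].
have excess_ub n : ubound (excess n) (2 * n%:R ^+ 2).
  move=> r [->|[T [G [<- ->]]]]; first by rewrite mulr_ge0 ?exprn_ge0.
  have : (pi3 G)%:R <= 2 * #|T|%:R ^+ 2 :> R.
    by rewrite -natrX -natrM ler_nat pi3_le_sqr.
  have : 0 <= #|T|%:R ^+ 2 :> R by rewrite exprn_ge0.
  lra.
have excess_sup n : has_sup (excess n).
  by split; [exists 0; left | exists (2 * n%:R ^+ 2)].
exists (fun n => sup (excess n)); split; last first.
  move=> n T G cT; rewrite addrC -lerBlDr; apply: sup_upper_bound => //.
  by right; exists T, G.
apply/eqoP => eps eps0; have [n0 n0P] := pi3_asymptotic eps0.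
exists n0 => // n /= n0n.
rewrite ger0_norm; last by apply: sup_upper_bound => //; left.
rewrite ger0_norm ?exprn_ge0 //; apply: sup_le_ub; first by exists 0; left.
move=> r [->|[T [G [cT ->]]]]; first by rewrite mulr_ge0 ?exprn_ge0 ?(ltW eps0).
by rewrite lerBlDl -cT; apply: n0P; rewrite cT.
Qed.
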